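(* Let $\mathbf{x}^\ast\in\mathcal{X}_0$ be any fixed (deterministic) point satisfying $\tilde{\mathbf{g}}(\mathbf{x}^\ast)\le\mathbf{0}$ componentwise (e.g. a minimizer of $\sum_{t=1}^T f^t(\mathbf{x})$ over $\mathcal{X}=\{\mathbf{x}\in\mathcal{X}_0:\tilde g_k(\mathbf{x})\le 0,\ \forall k\}$). If $V=\sqrt{T}$ and $\alpha=T$ in Algorithm 1 (defined in the context), then for all $T\ge1$, $$\mathbb{E}\Big[\sum_{t=1}^{T} f^t(\mathbf{x}(t))\Big]\le\mathbb{E}\Big[\sum_{t=1}^{T} f^t(\mathbf{x}^\ast)\Big]+O(\sqrt{T}),$$ where the expectation is with respect to all $\omega(t)$. That is, there is a constant $C$ depending only on $m,D_1,D_2,G,R,\epsilon$ such that the inequality holds with $C\sqrt{T}$ in place of $O(\sqrt T)$ for every integer $T\ge1$.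
   Context: Setting. $\mathcal{X}_0\subset\mathbb{R}^n$ is a nonempty compact convex set. $\omega$ is a random variable with values in $\Omega$, and $\omega(1),\omega(2),\ldots$ are i.i.d. samples of $\omega$. For $k\in\{1,\ldots,m\}$, $g_k(\mathbf{x};\omega)$ is convex in $\mathbf{x}\in\mathcal{X}_0$ for each $\omega\in\Omega$. Write $g_k^t(\mathbf{x})=g_k(\mathbf{x};\omega(t))$, $\mathbf{g}(\mathbf{x};\omega)=[g_1(\mathbf{x};\omega),\ldots,g_m(\mathbf{x};\omega)]^{\mathsf T}$, $\mathbf{g}^t(\mathbf{x})=\mathbf{g}(\mathbf{x};\omega(t))$, $\tilde g_k(\mathbf{x})=\mathbb{E}_\omega[g_k(\mathbf{x};\omega)]$, $\tilde{\mathbf g}=[\tilde g_1,\ldots,\tilde g_m]^{\mathsf T}$. The loss functions $f^t$, $t=1,2,\ldots$, are convex on $\mathcal{X}_0$ and may vary arbitrarily, as long as each $f^t$ is independent of all $\omega(\tau)$ with $\tau\ge t+1$ (for example $f^t$ may be chosen adversarially based on $\omega(1),\ldots,\omega(t)$ and $\mathbf{x}(1),\ldots,\mathbf{x}(t)$). The samples $\omega(\cdot)$ are the only source of randomness: with $\mathcal{W}(0)=\{\emptyset,\Omega\}$ the trivial $\sigma$-algebra and $\mathcal{W}(t)=\sigma(\omega(1),\ldots,\omega(t))$, $f^t$ is determined by $\omega(1),\ldots,\omega(t)$, and $\mathbf{x}(t)$ and $\mathbf{Q}(t)$ below are $\mathcal{W}(t-1)$-measurable for all $t\ge1$. $\|\cdot\|$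 is the Euclidean norm. $\nabla h(\mathbf{x})$ denotes a subgradient of the convex function $h$ at $\mathbf{x}$, i.e. $h(\mathbf{y})\ge h(\mathbf{x})+[\nabla h(\mathbf{x})]^{\mathsf T}[\mathbf{y}-\mathbf{x}]$ for all $\mathbf{y}\in\mathcal{X}_0$. Assumption (basic). There are constants $D_1,D_2,G,R>0$ such that $\|\nabla f^t(\mathbf{x})\|\le D_1$, $\|\nabla g_k(\mathbf{x};\omega)\|\le D_2$, $\|\mathbf{g}(\mathbf{x};\omega)\|\le G$ and $\|\mathbf{x}-\mathbf{y}\|\le R$ for all $\mathbf{x},\mathbf{y}\in\mathcal{X}_0$, all $t$, all $\omega\in\Omega$ and all $k$. Assumption (Slater). There are $\epsilon>0$ and $\hat{\mathbf{x}}\in\mathcal{X}_0$ with $\tilde g_k(\hat{\mathbf{x}})\le-\epsilon$ for all $k\in\{1,\ldots,m\}$. Algorithm 1. Parameters $V>0$, $\alpha>0$. Choose $\mathbf{x}(1)\in\mathcal{X}_0$ arbitrarily and set $Q_k(1)=0$ for all $k$. At the end of each round $t\in\{1,2,\ldots\}$, observe $f^t,\mathbf{g}^t$ and: (i) let $\mathbf{x}(t+1)$ be the minimizer over $\mathbf{x}\in\mathcal{X}_0$ of $V[\nabla f^t(\mathbf{x}(t))]^{\mathsf T}[\mathbf{x}-\mathbf{x}(t)]+\sum_{k=1}^m Q_k(t)[\nabla g_k^t(\mathbf{x}(t))]^{\mathsf T}[\mathbf{x}-\mathbf{x}(t)]+\alpha\|\mathbf{x}-\mathbf{x}(t)\|^2$;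 (ii) set $Q_k(t+1)=\max\{Q_k(t)+g_k^t(\mathbf{x}(t))+[\nabla g_k^t(\mathbf{x}(t))]^{\mathsf T}[\mathbf{x}(t+1)-\mathbf{x}(t)],0\}$ for each $k$. The same subgradients are used in (i) and (ii). Write $\mathbf{Q}(t)=[Q_1(t),\ldots,Q_m(t)]^{\mathsf T}$. *)

(* Defs.v *)
From HB Require Import structures.
From mathcomp Require Import all_boot all_order all_algebra.
From mathcomp Require Import finmap.
From mathcomp Require Import all_classical all_reals all_analysis.

Set Implicit Arguments.
Unset Strict Implicit.
Unset Printing Implicit Defensive.

Import Order.TTheory GRing.Theory Num.Theory.
Import numFieldNormedType.Exports.

Local Open Scope classical_set_scope.
Local Open Scope ring_scope.

Definition dot (R : realType) (n : nat) (u v : 'rV[R]_n) : R :=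
  \sum_(i < n) u ord0 i * v ord0 i.

(* The library's norm on matrices is the sup norm, hence this definition. *)
Definition enorm (R : realType) (n : nat) (u : 'rV[R]_n) : R :=
  Num.sqrt (dot u u).

(* The inequality is only required on [X0], so at a relative boundary point of
   [X0] the subgradients in this sense form an unbounded set. *)
Definition subgradient (R : realType) (n : nat) (X0 : set 'rV[R]_n)
    (h : 'rV[R]_n -> R) (x v : 'rV[R]_n) : Prop :=
  forall y, X0 y -> h x + dot v (y - x) <= h y.

Definition minimizer (R : realType) (n : nat) (X0 : set 'rV[R]_n)
    (h : 'rV[R]_n -> R) (x : 'rV[R]_n) : Prop :=
  X0 x /\ forall y, X0 y -> h x <= h y.

(* Mutual independence of the family [X] restricted to the indices in [I]. *)
Definition mutually_independent (d d' : measure_display)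
    (S : measurableType d) (Omega : measurableType d') (R : realType)
    (P : probability S R) (I : set nat) (X : nat -> S -> Omega) : Prop :=
  forall (J : {fset nat}) (A : nat -> set Omega),
    [set` J] `<=` I -> (forall j, j \in J -> measurable (A j)) ->
    P (\bigcap_(j in [set` J]) X j @^-1` A j) =
    (\prod_(j <- J) P (X j @^-1` A j))%E.

(* Samples are indexed from 1; the value at index 0 is ignored. *)
Definition iid_samples (d d' : measure_display)
    (S : measurableType d) (Omega : measurableType d') (R : realType)
    (P : probability S R) (om : {RV P >-> Omega})
    (omega : nat -> {RV P >-> Omega}) : Prop :=
  mutually_independent P [set t | (1 <= t)%N]
    (fun t => omega t : S -> Omega) /\
  forall t, (1 <= t)%N -> forall A : set Omega, measurable A ->
    distribution P (omega t) A = distribution P om A.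

(* [past omega t] is [S] equipped with the sigma-algebra generated by
   omega 1, ..., omega t; for t = 0 this is the trivial sigma-algebra. *)
Definition past (d d' : measure_display)
    (S : measurableType d) (Omega : measurableType d')
    (omega : nat -> S -> Omega) (t : nat) :=
  g_sigma_algebraType
    (\bigcup_(i in [set i | (1 <= i <= t)%N])
       preimage_set_system [set: S] (omega i) measurable).

(* R^n with its Borel sigma-algebra. *)
Definition borel_rV (R : realType) (n : nat) :=
  g_sigma_algebraType (@open 'rV[R]_n).

(* Objective minimized in one round, at the current iterate [x] and queue [Q]:
   [u] is the subgradient of the loss, [v k] that of the k-th constraint. *)
Definition objective (R : realType) (m n : nat) (V alpha : R)
    (Q : 'rV[R]_m) (x u : 'rV[R]_n) (v : 'I_m -> 'rV[R]_n)
    (y : 'rV[R]_n) : R :=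
  V * dot u (y - x) + \sum_(k < m) Q ord0 k * dot (v k) (y - x)
  + alpha * enorm (y - x) ^+ 2.

(* One sample path of the algorithm: [df t y] stands for the subgradient of
   f^t at y, [g t k] for the function g_k^t, and [dg t k y] for its subgradient
   at y.  Rounds are indexed from 1; [x 0] and [Q 0] are ignored. *)
Definition algorithm_run (R : realType) (m n : nat) (X0 : set 'rV[R]_n)
    (V alpha : R) (x1 : 'rV[R]_n) (df : nat -> 'rV[R]_n -> 'rV[R]_n)
    (g : nat -> 'I_m -> 'rV[R]_n -> R)
    (dg : nat -> 'I_m -> 'rV[R]_n -> 'rV[R]_n)
    (x : nat -> 'rV[R]_n) (Q : nat -> 'rV[R]_m) : Prop :=
  [/\ x 1%N = x1,
      forall k, Q 1%N ord0 k = 0 &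
      forall t, (1 <= t)%N ->
        minimizer X0
          (objective V alpha (Q t) (x t) (df t (x t))
             (fun k => dg t k (x t)))
          (x t.+1) /\
        forall k, Q t.+1 ord0 k =
          Num.max (Q t ord0 k + g t k (x t)
                   + dot (dg t k (x t)) (x t.+1 - x t)) 0].

(* Main.v *)
Require Import Defs.
From HB Require Import structures.
From mathcomp Require Import all_boot all_order all_algebra.
From mathcomp Require Import ring lra finmap.
From mathcomp Require Import all_classical all_reals all_analysis.
From mathcomp Require Import measurable_realfun.

Import Order.TTheory GRing.Theory Num.Theory.
Import numFieldNormedType.Exports.

Local Open Scope classical_set_scope.
Local Open Scope ring_scope.

(** The proof is a drift-plus-penalty argument.  Along each sample path, one
    adds three things for a single round: the growth of the Lyapunov function
    [enorm (Q t) ^+ 2 / 2], the strong convexity of the objective, which turns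
    the minimality of [x t.+1] into the inequality [prox_minimizer] against an
    arbitrary competitor [z] in [X0], and the subgradient inequalities, which
    replace linearized losses and constraints at [z] by their true values.  The
    linear terms [Q_k <dg_k, x t.+1 - x t>] produced by the queue update are
    exactly those of the objective, so they cancel, and the loss term
    [V <df, x t.+1 - x t>] is absorbed by the proximal term.  This is
    [drift_plus_penalty].  Summing over the rounds, the queue and distance terms
    telescope and [regret_path] bounds [V] times the regret by
    [a Rd^2 + T * drift_const] plus the cross term
    [\sum_t \sum_k Q_k(t) g_k^t(z)]; with [V = sqrt T] and [a = T], the first
    two summands are of order [T], hence of order [sqrt T] after division
    by [V].

    What remains is that the cross term has nonpositive mean for [z = xstar].
    The queue [Q t] is a function of [omega 1, ..., omega t.-1], and the family
    is independent, so by the pi-lambda theorem ([past_indep]) [Q t] is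
    independent of [omega t]; since the queue is bounded by a deterministic
    quantity, the mean of [Q_k(t) g_k^t(xstar)] is the product of the nonnegative
    mean of [Q_k(t)] and the nonpositive mean of [g_k(xstar)]
    ([expectation_mul_indep], [cross_term_nonpos_mean]).

    The losses may fail to be integrable: only their increments over [X0] are
    bounded.  The passage from the pathwise inequality to expectations therefore
    goes through [expectation_le_add_bounded], which holds in the extended reals
    whether or not the comparison loss is integrable. *)

(** * The Euclidean inner product *)

Section Euclidean.
Context {R : realType} {n : nat}.
Implicit Types (u v w x y : 'rV[R]_n) (a s : R).

Lemma dotC u v : dot u v = dot v u.
Proof. by apply: eq_bigr => i _; rewrite mulrC. Qed.

Lemma dotDr u v w : dot u (v + w) = dot u v + dot u w.
Proof. by rewrite -big_split; apply: eq_bigr => i _; rewrite mxE mulrDr. Qed.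

Lemma dotZr a u v : dot u (a *: v) = a * dot u v.
Proof. by rewrite mulr_sumr; apply: eq_bigr => i _; rewrite mxE mulrCA. Qed.

Lemma dotDl u v w : dot (u + v) w = dot u w + dot v w.
Proof. by rewrite !(dotC _ w) dotDr. Qed.

Lemma dotZl a u v : dot (a *: u) v = a * dot u v.
Proof. by rewrite !(dotC _ v) dotZr. Qed.

Lemma dotBr u v w : dot u (v - w) = dot u v - dot u w.
Proof. by rewrite -scaleN1r dotDr dotZr mulN1r. Qed.

Lemma dotBl u v w : dot (u - v) w = dot u w - dot v w.
Proof. by rewrite !(dotC _ w) dotBr. Qed.

Lemma dot_suml m (F : 'I_m -> 'rV[R]_n) v :
  dot (\sum_k F k) v = \sum_k dot (F k) v.
Proof.
rewrite exchange_big; apply: eq_bigr => i _.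
by rewrite summxE mulr_suml.
Qed.

Lemma dot_ge0 u : 0 <= dot u u.
Proof. by apply: sumr_ge0 => i _; rewrite -expr2 sqr_ge0. Qed.

Lemma enorm_ge0 u : 0 <= enorm u.
Proof. exact: sqrtr_ge0. Qed.

Lemma sqr_enorm u : enorm u ^+ 2 = dot u u.
Proof. by rewrite sqr_sqrtr// dot_ge0. Qed.

Lemma ler_enorm_coord u i : `|u ord0 i| <= enorm u.
Proof.
rewrite -sqrtr_sqr ler_wsqrtr// /dot (bigD1 i)//= -expr2 lerDl.
by apply: sumr_ge0 => j _; rewrite -expr2 sqr_ge0.
Qed.

Lemma Cauchy_Schwarz u v : `|dot u v| <= enorm u * enorm v.
Proof.
have [v0|v_neq0] := eqVneq (dot v v) 0.
  have v_eq0 i : v ord0 i = 0.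
    apply/eqP; rewrite -normr_le0 (le_trans (ler_enorm_coord v i))//.
    by rewrite /enorm v0 sqrtr0.
  by rewrite /dot big1 ?normr0 ?mulr_ge0 ?enorm_ge0// => i _; rewrite v_eq0 mulr0.
rewrite -sqrtrM ?dot_ge0// -sqrtr_sqr ler_wsqrtr//.
(* The vector below is [dot v v] times the component of [u] orthogonal to [v]. *)
have := dot_ge0 (dot v v *: u - dot u v *: v).
rewrite !(dotBl, dotBr, dotZl, dotZr) (dotC v u) => h.
have v_gt0 : 0 < dot v v by rewrite lt_neqAle eq_sym v_neq0 dot_ge0.
rewrite -(ler_pM2l v_gt0) -subr_ge0; apply: le_trans h _.
by rewrite le_eqVlt; apply/orP; left; apply/eqP; ring.
Qed.

Lemma convex_set_segment (X0 : set 'rV[R]_n) x y s :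
  convex_set X0 -> X0 x -> X0 y -> 0 <= s <= 1 -> X0 (x + s *: (y - x)).
Proof.
move=> cX Xx Xy /andP[s0 s1].
have := cX y x (Itv01 s0 s1) (mem_set Xy) (mem_set Xx).
rewrite inE; congr X0.
have -> : conv (Itv01 s0 s1) (y : convex_lmodType _) x = s *: y + (1 - s) *: x by [].
by rewrite scalerBr scalerBl scale1r addrC -addrA [- _ + _]addrC.
Qed.

(** The objective is a quadratic with leading term [a * enorm ^+ 2]: expanding
    it around the minimizer [x'] in the direction [y - x'] gives its value at
    [x'], a linear term [L], and [a * enorm (y - x') ^+ 2].  Minimality along
    the segment forces [L] to be nonnegative. *)
Lemma prox_minimizer (X0 : set 'rV[R]_n) w a x x' y :
  convex_set X0 -> 0 <= a ->
  minimizer X0 (fun z => dot w (z - x) + a * enorm (z - x) ^+ 2) x' ->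
  X0 y ->
  dot w (x' - x) + a * enorm (x' - x) ^+ 2 + a * enorm (y - x') ^+ 2
    <= dot w (y - x) + a * enorm (y - x) ^+ 2.
Proof.
move=> cX a_ge0 [Xx' x'_min] Xy.
rewrite !sqr_enorm; set d := y - x'.
pose L := dot w d + 2 * a * dot (x' - x) d.
have expand (s : R) : dot w (x' + s *: d - x) + a * dot (x' + s *: d - x) (x' + s *: d - x)
    = dot w (x' - x) + a * dot (x' - x) (x' - x) + s * L + s ^+ 2 * (a * dot d d).
  rewrite /L addrAC; move: (x' - x) => e; clearbody d.
  by rewrite !(dotDl, dotDr, dotZl, dotZr) (dotC d e); ring.
have -> : y - x = x' + 1 *: d - x by rewrite scale1r /d [x' + _]addrC subrK.
rewrite expand expr1n !mul1r lerD2r lerDl.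
rewrite leNgt; apply/negP => L_lt0.
have A_ge0 : 0 <= a * dot d d by rewrite mulr_ge0// dot_ge0.
(* If [L < 0], this step decreases the objective by [s ^+ 2 * - L]; the [- L]
   in the denominator keeps it inside the segment. *)
pose s := - L / (a * dot d d - L).
have den_gt0 : 0 < a * dot d d - L by lra.
have s_gt0 : 0 < s by rewrite divr_gt0// oppr_gt0.
have s_le1 : s <= 1 by rewrite ler_pdivrMr// mul1r; lra.
have sE : s * (a * dot d d - L) = - L by rewrite /s divfK// gt_eqF.
have /x'_min : X0 (x' + s *: d).
  by apply: convex_set_segment => //; rewrite (ltW s_gt0).
rewrite !sqr_enorm expand -addrA lerDl.
have -> : s * L + s ^+ 2 * (a * dot d d) = s ^+ 2 * L by rewrite -[L in s * L]opprK -sE; ring.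
by rewrite leNgt pmulr_rlt0 ?exprn_gt0// L_lt0.
Qed.

End Euclidean.

(** * The pathwise regret bound *)

Section DriftPlusPenalty.
Context {R : realType} {m n : nat}.
Variables (X0 : set 'rV[R]_n) (V a D1 D2 G Rd : R).
Hypotheses (cX0 : convex_set X0) (V_ge0 : 0 <= V) (a_gt0 : 0 < a).

(** What one round adds to the bound: the first summand bounds half the sum of
    the squared queue increments, the second is the price of absorbing the linearized
    loss into the proximal term. *)
Definition drift_const : R :=
  m%:R * (G + D2 * Rd) ^+ 2 / 2 + V ^+ 2 * D1 ^+ 2 / (4 * a).

Lemma queue_drift (Q Q' : 'rV[R]_m) (h : 'I_m -> R) (H : R) :
  (forall k, Q' ord0 k = Num.max (Q ord0 k + h k) 0) ->
  (forall k, `|h k| <= H) ->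
  enorm Q' ^+ 2 <= enorm Q ^+ 2 + 2 * \sum_k Q ord0 k * h k + m%:R * H ^+ 2.
Proof.
move=> Q'E hH.
have -> : m%:R * H ^+ 2 = \sum_(k < m) H ^+ 2.
  by rewrite sumr_const card_ord mulr_natl.
rewrite !sqr_enorm mulr_sumr -!big_split /=; apply: ler_sum => k _.
have : `|h k| ^+ 2 <= H ^+ 2 by rewrite ler_sqr ?nnegrE// (le_trans _ (hH k)).
rewrite -normrX ger0_norm ?sqr_ge0// => hH2.
rewrite Q'E; move: (Q ord0 k) (h k) hH2 => q c hH2.
have := sqr_ge0 (q + c).
by rewrite /Order.max; case: ifP => _; nra.
Qed.

(** The terms [Q_k <v_k, x' - x>] occur in the drift of the queues and in the
    objective at its minimizer [x'], and cancel; [prox_minimizer] then compares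
    [x'] with [z], and the subgradient inequalities turn the linearizations at
    [z] into [fz] and [gz]. *)
Lemma drift_plus_penalty (Q Q' : 'rV[R]_m) (x x' z u : 'rV[R]_n)
    (v : 'I_m -> 'rV[R]_n) (gx gz : 'I_m -> R) (fx fz : R) :
  X0 z -> (forall k, 0 <= Q ord0 k) ->
  fx + dot u (z - x) <= fz ->
  (forall k, gx k + dot (v k) (z - x) <= gz k) ->
  enorm u <= D1 -> (forall k, enorm (v k) <= D2) ->
  (forall k, `|gx k| <= G) -> enorm (x' - x) <= Rd ->
  minimizer X0 (objective V a Q x u v) x' ->
  (forall k, Q' ord0 k =
     Num.max (Q ord0 k + gx k + dot (v k) (x' - x)) 0) ->
  enorm Q' ^+ 2 / 2 + a * enorm (z - x') ^+ 2 + V * (fx - fz) <=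
  enorm Q ^+ 2 / 2 + a * enorm (z - x) ^+ 2 + \sum_k Q ord0 k * gz k
    + drift_const.
Proof.
move=> Xz Q_ge0 fz_ge gz_ge u_le v_le gx_le d_le x'_min Q'E.
pose h k := gx k + dot (v k) (x' - x).
have h_le k : `|h k| <= G + D2 * Rd.
  rewrite (le_trans (ler_normD _ _))// lerD//.
  rewrite (le_trans (Cauchy_Schwarz _ _))//.
  by apply: ler_pM => //; exact: enorm_ge0.
have drift : enorm Q' ^+ 2 <= enorm Q ^+ 2 + 2 * \sum_k Q ord0 k * h k
    + m%:R * (G + D2 * Rd) ^+ 2.
  by apply: queue_drift => // k; rewrite Q'E addrA.
pose w := V *: u + \sum_k Q ord0 k *: v k.
have objE : objective V a Q x u v =
    (fun y => dot w (y - x) + a * enorm (y - x) ^+ 2).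
  apply/funext => y; rewrite /objective dotDl dotZl dot_suml.
  by congr (_ + _ + _); apply: eq_bigr => k _; rewrite dotZl.
rewrite objE in x'_min.
have prox := prox_minimizer _ _ _ _ _ _ cX0 (ltW a_gt0) x'_min Xz.
have wE y : dot w y = V * dot u y + \sum_k Q ord0 k * dot (v k) y.
  by rewrite dotDl dotZl dot_suml; congr (_ + _); apply: eq_bigr => k _;
    rewrite dotZl.
rewrite !wE in prox.
have Qz_le : \sum_k Q ord0 k * dot (v k) (z - x) + \sum_k Q ord0 k * gx k
    <= \sum_k Q ord0 k * gz k.
  rewrite -big_split /=; apply: ler_sum => k _.
  by rewrite -mulrDr ler_wpM2l// addrC.
have QhE : \sum_k Q ord0 k * h k =
    \sum_k Q ord0 k * gx k + \sum_k Q ord0 k * dot (v k) (x' - x).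
  by rewrite -big_split /=; apply: eq_bigr => k _; rewrite mulrDr.
have Vu_le : V * dot u (z - x) <= V * (fz - fx).
  by rewrite ler_wpM2l// lerBrDl.
(* Completing the square in [enorm (x' - x)]. *)
have young : - (V * dot u (x' - x)) <=
    V ^+ 2 * D1 ^+ 2 / (4 * a) + a * enorm (x' - x) ^+ 2.
  have e_ge0 := enorm_ge0 (x' - x).
  set e := enorm (x' - x) in d_le e_ge0 *.
  have dot_le : - dot u (x' - x) <= D1 * e.
    rewrite (le_trans (ler_norm _))// normrN (le_trans (Cauchy_Schwarz _ _))//.
    by rewrite ler_wpM2r.
  rewrite -mulrN; apply: (@le_trans _ _ (V * (D1 * e))).
    by rewrite ler_wpM2l.
  rewrite -subr_ge0.
  have -> : V ^+ 2 * D1 ^+ 2 / (4 * a) + a * e ^+ 2 - V * (D1 * e) =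
      (V * D1 - 2 * a * e) ^+ 2 / (4 * a) by field; rewrite gt_eqF.
  by rewrite divr_ge0 ?sqr_ge0// mulr_ge0// ltW.
rewrite /drift_const; move: drift prox; rewrite QhE => drift prox.
lra.
Qed.

(** The bound on the queues accompanies the regret bound because it makes the
    cross term [\sum_t \sum_k Q t k * g t k z] integrable. *)
Lemma regret_path (f : nat -> 'rV[R]_n -> R) (df : nat -> 'rV[R]_n -> 'rV[R]_n)
    (g : nat -> 'I_m -> 'rV[R]_n -> R)
    (dg : nat -> 'I_m -> 'rV[R]_n -> 'rV[R]_n)
    (x1 z : 'rV[R]_n) (x : nat -> 'rV[R]_n) (Q : nat -> 'rV[R]_m) :
  X0 x1 -> X0 z ->
  (forall t y, (1 <= t)%N -> X0 y -> subgradient X0 (f t) y (df t y)) ->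
  (forall t k y, X0 y -> subgradient X0 (g t k) y (dg t k y)) ->
  (forall t y, (1 <= t)%N -> X0 y -> enorm (df t y) <= D1) ->
  (forall t k y, X0 y -> enorm (dg t k y) <= D2) ->
  (forall t k y, X0 y -> `|g t k y| <= G) ->
  (forall y y', X0 y -> X0 y' -> enorm (y - y') <= Rd) ->
  algorithm_run X0 V a x1 df g dg x Q ->
  forall T,
  (forall k, 0 <= Q T.+1 ord0 k <= T%:R * (G + D2 * Rd)) /\
      V * \sum_(1 <= t < T.+1) (f t (x t) - f t z) <=
      a * Rd ^+ 2 + T%:R * drift_const
      + \sum_(1 <= t < T.+1) \sum_k Q t ord0 k * g t k z.
Proof.
move=> Xx1 Xz sf sg df_le dg_le g_le diam [x1E Q1 step] T.
have x_in t : (1 <= t)%N -> X0 (x t).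
  by case: t => [//|[|t]] _; [rewrite x1E|have [[]] := step t.+1 isT].
have Q_bounds t k : 0 <= Q t.+1 ord0 k <= t%:R * (G + D2 * Rd).
  elim: t => [|t /andP[Q_ge0 Q_le]]; first by rewrite Q1 mul0r lexx.
  have [_ ->] := step t.+1 isT.
  have Xt := x_in t.+1 isT.
  have g_le' := le_trans (ler_norm _) (g_le t.+1 k _ Xt).
  have d_le : dot (dg t.+1 k (x t.+1)) (x t.+2 - x t.+1) <= D2 * Rd.
    rewrite (le_trans (ler_norm _))// (le_trans (Cauchy_Schwarz _ _))//.
    apply: ler_pM; [exact: enorm_ge0|exact: enorm_ge0|exact: dg_le|].
    by apply: diam => //; exact: x_in.
  have H_ge0 : 0 <= G + D2 * Rd.
    rewrite addr_ge0 ?(le_trans _ (g_le t.+1 k _ Xt))// mulr_ge0//.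
      exact: le_trans (enorm_ge0 _) (dg_le t.+1 k _ Xt).
    exact: le_trans (enorm_ge0 _) (diam _ _ Xt Xt).
  rewrite le_max lexx orbT/= ge_max mulr_ge0 ?ler0n// andbT.
  by rewrite -natr1 mulrDl mul1r; lra.
split=> [//|].
have diam1 : enorm (z - x 1%N) ^+ 2 <= Rd ^+ 2.
  have d_le := diam _ _ Xz (x_in 1%N isT).
  by rewrite ler_sqr ?nnegrE ?enorm_ge0// (le_trans (enorm_ge0 _) d_le).
have Q1_norm : enorm (Q 1%N) ^+ 2 = 0.
  by rewrite sqr_enorm /dot big1// => k _; rewrite Q1 mul0r.
have telescope : enorm (Q T.+1) ^+ 2 / 2 + a * enorm (z - x T.+1) ^+ 2
    + V * \sum_(1 <= t < T.+1) (f t (x t) - f t z) <=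
    a * enorm (z - x 1%N) ^+ 2 + T%:R * drift_const
      + \sum_(1 <= t < T.+1) \sum_k Q t ord0 k * g t k z.
  elim: T => [|T IH].
    by rewrite !big_geq// Q1_norm; lra.
  rewrite [\sum_(1 <= t < T.+2) (f t (x t) - _)]big_nat_recr//=.
  rewrite [\sum_(1 <= t < T.+2) \sum_k _]big_nat_recr//=.
  have [x'_min Q'E] := step T.+1 isT.
  have Xt := x_in T.+1 isT.
  have Q_ge0 k : 0 <= Q T.+1 ord0 k by have /andP[] := Q_bounds T k.
  have := drift_plus_penalty _ _ _ _ _ _ _ _ _ _ _ Xz Q_ge0
    (sf T.+1 _ isT Xt _ Xz) (fun k => sg T.+1 k _ Xt _ Xz) (df_le T.+1 _ isT Xt)
    (fun k => dg_le T.+1 k _ Xt) (fun k => g_le T.+1 k _ Xt)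
    (diam _ _ (x_in T.+2 isT) Xt) x'_min Q'E.
  by rewrite mulrDr -[T.+1%:R]natr1 mulrDl mul1r; lra.
have : 0 <= a * enorm (z - x T.+1) ^+ 2 by rewrite mulr_ge0 ?sqr_ge0// ltW.
have : 0 <= enorm (Q T.+1) ^+ 2 by exact: sqr_ge0.
have : a * enorm (z - x 1%N) ^+ 2 <= a * Rd ^+ 2 by rewrite ler_pM2l.
lra.
Qed.

End DriftPlusPenalty.

(** * Expectations without integrability *)

Section ExpectationBounds.
Local Open Scope ereal_scope.
Context {d} {S : measurableType d} {R : realType}.

(** The integral of a nonnegative function is a supremum over the simple
    functions below it, so it is monotone on all functions, measurable or not.
    The realized loss [f t w (x t w)] is compared in this way, without a proof
    that it is measurable in [w]. *)
Lemma ge0_le_integral_nomeas (mu : {measure set S -> \bar R}) (f1 f2 : S -> \bar R) :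
  (forall x, 0 <= f1 x) -> (forall x, f1 x <= f2 x) ->
  \int[mu]_x f1 x <= \int[mu]_x f2 x.
Proof.
move=> f1_ge0 f12.
have f2_ge0 x : 0 <= f2 x by exact: le_trans (f12 x).
rewrite !ge0_integralTE//; apply: le_ereal_sup => _ [h h_le <-].
by exists h => // x; exact: le_trans (h_le x) (f12 x).
Qed.

Lemma le_integral_nomeas (mu : {measure set S -> \bar R}) (f1 f2 : S -> \bar R) :
  (forall x, f1 x <= f2 x) -> \int[mu]_x f1 x <= \int[mu]_x f2 x.
Proof.
move=> f12; rewrite (integralE _ _ f1) (integralE _ _ f2).
apply: leeB; apply: ge0_le_integral_nomeas => // x.
  by rewrite (@funepos_le _ _ setT f1 f2)// ?inE// => y _; exact: f12.
by rewrite (@funeneg_le _ _ setT f1 f2)// ?inE// => y _; exact: f12.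
Qed.

Lemma bounded_integrable (P : probability S R) (K : S -> R) (M : R) :
  measurable_fun [set: S] K -> (forall w, `|K w| <= M)%R ->
  P.-integrable [set: S] (EFin \o K).
Proof.
move=> mK K_le; apply: measurable_bounded_integrable => //.
  by apply: (@le_lt_trans _ _ 1); [exact: probability_le1|exact: ltry].
exists M; split; first exact: num_real.
by move=> N MN w _; exact: le_trans (K_le w) (ltW MN).
Qed.

(** When [H] is not integrable, adding a bounded function does not change which
    of its two parts has infinite integral, and [+oo - +oo] is [-oo] here: if
    the negative part of [H] has infinite integral, the left-hand side is [-oo];
    otherwise the right-hand side is [+oo]. *)
Lemma expectation_le_add_bounded (P : probability S R) (F H K : S -> R)
    (M c : R) :
  measurable_fun [set: S] H -> measurable_fun [set: S] K ->
  (forall w, `|K w| <= M)%R -> (forall w, F w <= H w + K w)%R ->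
  'E_P[K] <= c%:E -> 'E_P[F] <= 'E_P[H] + c%:E.
Proof.
move=> mH mK K_le F_le; rewrite unlock => EK.
have le_FHK : \int[P]_w (F w)%:E <= \int[P]_w (H w + K w)%:E.
  by apply: le_integral_nomeas => w; rewrite lee_fin.
apply: le_trans le_FHK _.
have iK := bounded_integrable P _ _ mK K_le.
pose h : S -> \bar R := EFin \o H.
pose hk : S -> \bar R := EFin \o (H \+ K)%R.
have mh : measurable_fun [set: S] h by exact/measurable_EFinP.
have [Hneg_oo|Hneg_fin] := eqVneq (\int[P]_w h^\- w) +oo.
  have HKneg_oo : \int[P]_w hk^\- w = +oo.
    have mHK : measurable_fun [set: S] hk^\-.
      apply: measurable_funeneg; apply/measurable_EFinP.
      exact: measurable_funD.
    apply/eqP; rewrite -leye_eq -Hneg_oo.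
    have : \int[P]_w h^\- w <=
        \int[P]_w (hk^\- w + `|M|%:E).
      apply: ge0_le_integral_nomeas => // w.
      have negE (u : R) : maxe (- u%:E) 0 = (Num.max (- u) 0)%:E by rewrite EFin_max.
      rewrite !funenegE [h w]/= [hk w]/= !negE -EFinD lee_fin.
      have := K_le w; have := ler_norm M.
      rewrite ler_norml => MM /andP[K1 K2].
      rewrite ge_max -!lerBlDr !le_max. rewrite /=.
      apply/andP; split; apply/orP; [left|right]; lra.
    rewrite (ge0_integralD _ measurableT _ mHK)// integral_cst//= probability_setT mule1 Hneg_oo.
    by rewrite !leye_eq; case: (\int[P]_w hk^\- w).
  by rewrite integralE HKneg_oo addeNy leNye.
have Hneg_lty : \int[P]_w h^\- w < +oo by rewrite ltey.
have [Hpos_oo|Hpos_fin] := eqVneq (\int[P]_w h^\+ w) +oo.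
  have -> : \int[P]_w (H w)%:E = +oo.
    rewrite integralE Hpos_oo addye//.
    by move: Hneg_lty; case: (\int[P]_w h^\- w).
  by rewrite addye// leey.
have iH : P.-integrable [set: S] h.
  apply/integrableP; split => //.
  have -> : \int[P]_w `|h w| = \int[P]_w (h^\+ w + h^\- w).
    by apply: eq_integral => w _; rewrite -/((abse \o h) w) fune_abse.
  have mhp := measurable_funepos mh; have mhn := measurable_funeneg mh.
  by rewrite (ge0_integralD _ measurableT _ mhp)// lte_add_pinfty// ltey.
by under eq_integral do rewrite EFinD; rewrite integralD// leeD2l.
Qed.

End ExpectationBounds.

(** * Independence *)

Section Independence.
Local Open Scope ereal_scope.
Context {d} {S : measurableType d} {R : realType} (P : probability S R).

(** Independence says that the joint law of [(U, V)] agrees with the product of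
    the marginal laws on rectangles, hence everywhere, and Fubini applies. *)
Lemma expectation_mul_indep (U V : {RV P >-> R}) (M : R) :
  (forall w, `|U w| <= M)%R -> (forall w, `|V w| <= M)%R ->
  (forall A B : set R, measurable A -> measurable B ->
     P (U @^-1` A `&` V @^-1` B) = P (U @^-1` A) * P (V @^-1` B)) ->
  'E_P[(U \* V)%R] = 'E_P[U] * 'E_P[V].
Proof.
move=> U_le V_le indep; rewrite unlock.
have mU : measurable_fun [set: S] U by [].
have mV : measurable_fun [set: S] V by [].
pose Z w : R * R := (U w, V w).
have mZ : measurable_fun [set: S] Z by exact: measurable_fun_pair.
pose ZRV : {RV P >-> (R * R)%type} := mfun_Sub (mem_set mZ).
pose prod_f : R * R -> \bar R := fun p => (p.1 * p.2)%:E.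
have mprod : measurable_fun [set: R * R] prod_f.
  apply/measurable_EFinP; apply: measurable_funM.
    exact: measurable_fst.
  exact: measurable_snd.
have iU := bounded_integrable P _ _ mU U_le.
have iV := bounded_integrable P _ _ mV V_le.
have iUV : P.-integrable [set: S] (prod_f \o Z).
  apply: (bounded_integrable P (U \* V)%R (M * M)).
    exact: measurable_funM.
  by move=> w; rewrite normrM ler_pM.
have lawE (A : set (R * R)) : measurable A -> A `<=` setT ->
    distribution P ZRV A = (distribution P U \x distribution P V) A.
  by move=> mA _; symmetry; apply: product_measure_unique.
have prodE (h : R * R -> \bar R) :
    \int[distribution P ZRV]_p h p
      = \int[distribution P U \x distribution P V]_p h p.
  exact: eq_measure_integral.
have iprod : (distribution P U \x distribution P V).-integrable setT prod_f.
  apply/integrableP; split => //; rewrite -prodE.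
  by have /integrableP[] := integrable_pushforward mZ mprod iUV measurableT.
have mE : measurable_fun [set: R] (EFin : R -> \bar R).
  by apply/measurable_EFinP.
have idistV := integrable_pushforward mV mE iV measurableT.
have idistU := integrable_pushforward mU mE iU measurableT.
have E_V : \int[distribution P V]_y y%:E = \int[P]_w (V w)%:E.
  by rewrite integral_distribution.
have E_U : \int[distribution P U]_y y%:E = \int[P]_w (U w)%:E.
  by rewrite integral_distribution.
transitivity (\int[distribution P ZRV]_p prod_f p).
  by rewrite integral_distribution.
rewrite prodE -integral12_prod_meas1// /fubini_F.
under eq_integral do rewrite /prod_f/=.
rewrite (eq_integral (fun x : R => x%:E * \int[P]_w (V w)%:E)); last first.
  move=> x _; rewrite -E_V -integralZl//.
have fV : \int[P]_w (V w)%:E \is a fin_num by exact: integrable_fin_num.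
by rewrite -(fineK fV) integralZr// E_U.
Qed.

End Independence.

Section Past.
Local Open Scope ereal_scope.
Context {d d'} {S : measurableType d} {Omega : measurableType d'} {R : realType}.
Variables (P : probability S R) (omega : nat -> {RV P >-> Omega}).

Lemma past_measurable t (A : set S) :
  measurable (A : set (past (fun t => omega t : S -> Omega) t)) -> measurable A.
Proof.
apply: smallest_sub; first exact: sigma_algebra_measurable.
by move=> _ [i _ [B mB <-]]; exact: measurable_funP.
Qed.

Lemma past_measurable_fun d1 (U : measurableType d1) t (h : S -> U) :
  measurable_fun [set: past (fun t => omega t : S -> Omega) t] h ->
  measurable_fun [set: S] h.
Proof. by move=> mh _ B mB; apply: past_measurable; exact: mh. Qed.

(** The cylinders form a pi-system that generates the past, and mutual
    independence speaks of exactly these sets. *)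
Definition past_cylinders (t : nat) : set (set S) :=
  [set A | exists2 F : nat -> set Omega, (forall i, measurable (F i)) &
     A = \bigcap_(i in [set i | (1 <= i <= t)%N]) omega i @^-1` F i].

Lemma past_cylinders_setI_closed t : setI_closed (past_cylinders t).
Proof.
move=> _ _ [F mF ->] [G mG ->]; exists (fun i => F i `&` G i).
  by move=> i; exact: measurableI.
by rewrite -bigcapI.
Qed.

Lemma past_cylinders_measurable t : past_cylinders t `<=` measurable.
Proof.
move=> _ [F mF ->]; rewrite bigcap_mkcond.
apply: bigcapT_measurable => i; case: ifP => // _; rewrite -[X in measurable X]setTI; exact: measurable_funP.
Qed.

Lemma past_sub_cylinders t (A : set S) :
  measurable (A : set (past (fun t => omega t : S -> Omega) t)) ->
  <<s past_cylinders t >> A.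
Proof.
apply: smallest_sub; first exact: smallest_sigma_algebra.
move=> _ [i /= it [B mB <-]]; apply: sub_sigma_algebra.
exists (fun j => if j == i then B else setT).
  by move=> j; case: ifP.
rewrite setTI; apply/seteqP; split => [w Bw j _ /=|w /(_ i it)/=].
  by case: eqP => [->|].
by rewrite eqxx.
Qed.

Lemma cylinder_indep t (F : nat -> set Omega) (B : set Omega) :
  mutually_independent P [set t | (1 <= t)%N] (fun t => omega t : S -> Omega) ->
  (forall i, measurable (F i)) -> measurable B ->
  let A := \bigcap_(i in [set i | (1 <= i <= t)%N]) omega i @^-1` F i in
  P (A `&` omega t.+1 @^-1` B) = P (omega t.+1 @^-1` B) * P A.
Proof.
move=> indep mF mB /=.
pose J := [fset i in iota 1 t]%fset.
have JE : [set` J] = [set i | (1 <= i <= t)%N].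
  by apply/seteqP; split => i /=; rewrite !inE mem_iota add1n.
pose F' i := if i == t.+1 then B else F i.
have mF' i : measurable (F' i) by rewrite /F'; case: ifP.
have tJ : (t.+1 \notin J)%fset by rewrite !inE mem_iota add1n ltnn andbF.
have F'J i : i \in J -> F' i = F i.
  by rewrite /F'; case: eqP => // ->; rewrite (negPf tJ).
have J_ge1 : [set` J] `<=` [set t | (1 <= t)%N].
  by rewrite JE => i /andP[].
have J'_ge1 : [set` (t.+1 |` J)%fset] `<=` [set t | (1 <= t)%N].
  by move=> i /=; rewrite in_fset1U => /orP[/eqP->//|]; exact: J_ge1.
have := indep (t.+1 |` J)%fset F' J'_ge1 (fun i _ => mF' i).
rewrite big_fsetU1//= {2}/F' eqxx.
have -> : \prod_(j <- J) P (omega j @^-1` F' j) =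
    \prod_(j <- J) P (omega j @^-1` F j).
  by rewrite big_seq [RHS]big_seq; apply: eq_bigr => j /F'J ->.
rewrite -(indep J F J_ge1 (fun i _ => mF i)) -JE => <-.
congr (P _); apply/seteqP; split => w /=.
  move=> [wF wB] i /=; rewrite in_fset1U => /orP[/eqP->|iJ].
    by rewrite /F' eqxx.
  by rewrite F'J//; exact: wF.
move=> wF; split => [i /= iJ|].
  by have := wF i; rewrite /= in_fset1U iJ orbT F'J//; exact.
by have := wF t.+1; rewrite /= in_fset1U eqxx /F' eqxx; exact.
Qed.

(** For fixed [B], both sides are finite measures in [A] that agree on the
    cylinders, so they agree on the sigma-algebra that these generate. *)
Lemma past_indep t (A : set S) (B : set Omega) :
  mutually_independent P [set t | (1 <= t)%N] (fun t => omega t : S -> Omega) ->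
  measurable (A : set (past (fun t => omega t : S -> Omega) t)) -> measurable B ->
  P (A `&` omega t.+1 @^-1` B) = P A * P (omega t.+1 @^-1` B).
Proof.
move=> indep mA mB.
have mC : measurable (omega t.+1 @^-1` B).
  rewrite -[X in measurable X]setTI; exact: measurable_funP.
have PC_ge0 : (0 <= fine (P (omega t.+1 @^-1` B)))%R by exact: fine_ge0.
have PCE : (fine (P (omega t.+1 @^-1` B)))%:E = P (omega t.+1 @^-1` B).
  by rewrite fineK// fin_num_measure.
pose m1 := mrestr P mC.
pose m2 := mscale (NngNum PC_ge0) P.
suff : m1 A = m2 A by rewrite -[m2 A]/(_%:E * P A) PCE muleC.
apply: (g_sigma_algebra_measure_unique (past_cylinders t) _ (fun=> setT)).
- exact: past_cylinders_measurable.
- move=> _; exists (fun=> setT) => //.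
  by apply/seteqP; split => // w _ i _.
- by rewrite bigcup_const//; exists 0%N.
- exact: past_cylinders_setI_closed.
- move=> _ [F mF ->]; rewrite -[RHS]/(_%:E * P _) PCE.
  exact: cylinder_indep.
- by move=> _; rewrite /m1 /mrestr (le_lt_trans (probability_le1 _ _)) ?ltry//; exact: measurableI.
- exact: past_sub_cylinders.
Qed.

End Past.

(** * The cross term has nonpositive mean *)

Section NonposMean.
Local Open Scope ereal_scope.
Context {d} {S : measurableType d} {R : realType} (P : probability S R).

(** The three conditions are kept together because they are what a finite sum of
    cross terms inherits from its summands; boundedness provides the
    integrability that the additivity of the mean requires. *)
Definition bounded_nonpos_mean (K : S -> R) : Prop :=
  [/\ measurable_fun [set: S] K, exists M, forall w, (`|K w| <= M)%R &
      'E_P[K] <= 0].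

Lemma bounded_nonpos_mean_sum (I : eqType) (s : seq I) (F : I -> S -> R) :
  (forall i, i \in s -> bounded_nonpos_mean (F i)) ->
  bounded_nonpos_mean (fun w => \sum_(i <- s) F i w)%R.
Proof.
elim: s => [|i s IH] Fs.
  have -> : (fun w => \sum_(i <- [::]) F i w)%R = cst 0%R.
    by apply/funext => w; rewrite big_nil.
  by split; [|exists 0%R => w; rewrite normr0|rewrite expectation_cst].
have -> : (fun w => \sum_(j <- i :: s) F j w)%R =
    (fun w => F i w + \sum_(j <- s) F j w)%R.
  by apply/funext => w; rewrite big_cons.
have [mFi [M Fi_le] EFi] := Fs i (mem_head _ _).
have [|mFs [N Fs_le] EFs] := IH.
  by move=> j js; apply: Fs; rewrite in_cons js orbT.
split.
- exact: measurable_funD.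
- by exists (M + N)%R => w; rewrite (le_trans (ler_normD _ _))// lerD.
- move: EFi EFs; rewrite unlock => EFi EFs.
  have iFi := bounded_integrable P _ _ mFi Fi_le.
  have iFs := bounded_integrable P _ _ mFs Fs_le.
  under eq_integral do rewrite EFinD.
  by rewrite (integralD _ iFi iFs)//; exact: adde_le0.
Qed.

Lemma expectation_le_add_nonpos_mean (F H K : S -> R) (r c : R) :
  measurable_fun [set: S] H -> bounded_nonpos_mean K -> (0 <= r)%R ->
  (forall w, F w <= H w + (r * K w + c))%R ->
  'E_P[F] <= 'E_P[H] + c%:E.
Proof.
move=> mH [mK [M K_le] EK] r_ge0 F_le.
have mrK : measurable_fun [set: S] (fun w => r * K w + c)%R.
  by apply: measurable_funD => //; exact: measurable_funM.
apply: (expectation_le_add_bounded _ _ _ _ (r * M + `|c|) _ mH mrK) => // [w|].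
  by rewrite (le_trans (ler_normD _ _))// lerD// normrM ger0_norm// ler_wpM2l.
move: EK; rewrite unlock => EK.
have iK := bounded_integrable P _ _ mK K_le.
have iC : P.-integrable [set: S] (EFin \o cst c).
  exact: (bounded_integrable P _ `|c|).
have irK := integrableZl measurableT r iK.
under eq_integral do rewrite EFinD EFinM.
rewrite (integralD _ irK iC)// (integralZl _ iK)//.
have := expectation_cst P c; rewrite unlock => ->.
by rewrite geeDr// mule_ge0_le0.
Qed.

End NonposMean.

Lemma measurable_coord (R : realType) (m : nat) (k : 'I_m) :
  measurable_fun [set: borel_rV R m] ((fun v : 'rV[R]_m => v ord0 k) : borel_rV R m -> R).
Proof.
apply: (measurability _ (RGenOpens.measurableE R)).
move=> _ [_ [a [b ->] <-]]; rewrite setTI; apply: sub_sigma_algebra.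
have := @coord_continuous R 1 m ord0 k.
by move/continuousP; apply; exact: interval_open.
Qed.

Section CrossTerm.
Local Open Scope ereal_scope.
Context {d d'} {S : measurableType d} {Omega : measurableType d'} {R : realType}.
Variables (P : probability S R) (om : {RV P >-> Omega}).
Variable omega : nat -> {RV P >-> Omega}.
Hypothesis iid : iid_samples om omega.

(** [q] is determined by the samples up to time [t] and so is independent of the
    next sample, whose law is that of [om]: the mean of the product is
    ['E_P[q] * 'E_P[h om]], a product of opposite signs. *)
Lemma cross_term_nonpos_mean t (q : S -> R) (h : Omega -> R) (M N : R) :
  measurable_fun [set: past (fun t => omega t : S -> Omega) t] q ->
  (forall w, 0 <= q w <= M)%R ->
  measurable_fun [set: Omega] h -> (forall o, `|h o| <= N)%R ->
  'E_P[fun w => h (om w)] <= 0 ->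
  bounded_nonpos_mean P (fun w => q w * h (omega t.+1 w))%R.
Proof.
move=> mq q_bd mh h_le Eh; have [indep same] := iid.
have mqS : measurable_fun [set: S] q by exact: past_measurable_fun mq.
have q_le w : (`|q w| <= M)%R.
  by have /andP[q0 qM] := q_bd w; rewrite ger0_norm.
have mhomega : measurable_fun [set: S] (fun w => h (omega t.+1 w)).
  exact: measurableT_comp.
have mhom : measurable_fun [set: S] (fun w => h (om w)).
  exact: measurableT_comp.
split; first exact: measurable_funM.
  exists (M * N)%R => w; rewrite normrM ler_pM//.
pose U : {RV P >-> R} := mfun_Sub (mem_set mqS).
pose V : {RV P >-> R} := mfun_Sub (mem_set mhomega).
have -> : (fun w => q w * h (omega t.+1 w))%R = (U \* V)%R by [].
rewrite (expectation_mul_indep P _ _ (Num.max M N)).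
- have -> : 'E_P[V] = 'E_P[fun w => h (om w)].
    rewrite unlock.
    have mE : measurable_fun [set: Omega] (EFin \o h) by exact/measurable_EFinP.
    have io := bounded_integrable P _ _ mhomega (fun w => h_le _).
    have iom := bounded_integrable P _ _ mhom (fun w => h_le _).
    rewrite -[LHS](integral_distribution (X := omega t.+1) mE io).
    rewrite -[RHS](integral_distribution (X := om) mE iom).
    by apply: eq_measure_integral => A mA _; exact: same.
  rewrite mule_ge0_le0// expectation_ge0// => w.
  by have /andP[] := q_bd w.
- by move=> w; rewrite le_max q_le.
- by move=> w; rewrite le_max h_le orbT.
- move=> A B mA mB.
  have -> : V @^-1` B = omega t.+1 @^-1` (h @^-1` B) by [].
  apply: past_indep => //.
    by rewrite -[U @^-1` A]setTI; exact: mq.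
  by rewrite -[h @^-1` B]setTI; exact: mh.
Qed.

End CrossTerm.

(** * The regret bound *)

Theorem theorem2 (R : realType) (m : nat) (D1 D2 G Rd eps : R) :
  0 < D1 -> 0 < D2 -> 0 < G -> 0 < Rd -> 0 < eps ->
  exists C : R,
  forall (n : nat) (X0 : set 'rV[R]_n)
    (d d' : measure_display) (S : measurableType d)
    (Omega : measurableType d') (P : probability S R)
    (om : {RV P >-> Omega}) (omega : nat -> {RV P >-> Omega})
    (g : 'I_m -> 'rV[R]_n -> Omega -> R)
    (dg : 'I_m -> 'rV[R]_n -> Omega -> 'rV[R]_n)
    (f : nat -> S -> 'rV[R]_n -> R)
    (df : nat -> S -> 'rV[R]_n -> 'rV[R]_n)
    (T : nat) (x1 : 'rV[R]_n)
    (x : nat -> S -> 'rV[R]_n) (Q : nat -> S -> 'rV[R]_m)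
    (xstar : 'rV[R]_n),
  (* the feasible set and the samples *)
  X0 !=set0 -> compact X0 -> convex_set X0 ->
  iid_samples om omega ->
  (* constraint functions *)
  (forall k o, convex_function X0 (fun y => g k y o)) ->
  (forall k y, X0 y -> measurable_fun [set: Omega] (g k y)) ->
  (forall k y o, X0 y -> subgradient X0 (fun z => g k z o) y (dg k y o)) ->
  (* loss functions; f^t is determined by omega 1, ..., omega t *)
  (forall t w, (1 <= t)%N -> convex_function X0 (f t w)) ->
  (forall t y, (1 <= t)%N -> X0 y ->
     measurable_fun [set: past omega t]
       ((fun w => f t w y) : past omega t -> R)) ->
  (forall t w y, (1 <= t)%N -> X0 y -> subgradient X0 (f t w) y (df t w y)) ->
  (* basic assumption *)
  (forall t w y, (1 <= t)%N -> X0 y -> enorm (df t w y) <= D1) ->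
  (forall k y o, X0 y -> enorm (dg k y o) <= D2) ->
  (forall y o, X0 y -> enorm (\row_(k < m) g k y o) <= G) ->
  (forall y z, X0 y -> X0 z -> enorm (y - z) <= Rd) ->
  (* Slater assumption *)
  (exists2 xhat, X0 xhat &
     forall k, ('E_P[fun w => g k xhat (om w)] <= (- eps)%:E)%E) ->
  (* the algorithm with V = sqrt T and alpha = T, T >= 1 *)
  (1 <= T)%N -> X0 x1 ->
  (forall w, algorithm_run X0 (Num.sqrt T%:R) T%:R x1
     (fun t => df t w)
     (fun t k y => g k y (omega t w))
     (fun t k y => dg k y (omega t w))
     (fun t => x t w) (fun t => Q t w)) ->
  (forall t, (1 <= t)%N ->
     measurable_fun [set: past omega t.-1]
       (x t : past omega t.-1 -> borel_rV R n)) ->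
  (forall t, (1 <= t)%N ->
     measurable_fun [set: past omega t.-1]
       (Q t : past omega t.-1 -> borel_rV R m)) ->
  (* the comparison point *)
  X0 xstar ->
  (forall k, ('E_P[fun w => g k xstar (om w)] <= 0)%E) ->
  ('E_P[fun w => (\sum_(1 <= t < T.+1) f t w (x t w))%R]
   <= 'E_P[fun w => (\sum_(1 <= t < T.+1) f t w xstar)%R]
      + (C * Num.sqrt T%:R)%:E)%E.
Proof.
move=> D1_gt0 D2_gt0 G_gt0 Rd_gt0 _.
exists (Rd ^+ 2 + m%:R * (G + D2 * Rd) ^+ 2 / 2 + D1 ^+ 2 / 4).
move=> n X0 d d' S Omega P om omega g dg f df T x1 x Q xstar _ _ cX0 iid _ mg
  sg _ mf sf df_le dg_le g_le diam _ T_ge1 Xx1 run _ mQ Xstar Estar.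
set C := (X in (X * _)%:E).
have T_gt0 : 0 < T%:R :> R by rewrite ltr0n.
have sqrtT_gt0 : 0 < Num.sqrt T%:R :> R by rewrite sqrtr_gt0.
have sqrtT2 : Num.sqrt T%:R ^+ 2 = T%:R :> R by rewrite sqr_sqrtr// ltW.
have gk_le k y o : X0 y -> `|g k y o| <= G.
  move=> Xy; have := ler_enorm_coord (\row_(k < m) g k y o) k.
  by rewrite mxE => /le_trans; apply; exact: g_le.
have path w := regret_path X0 _ _ D1 D2 G Rd cX0 (ltW sqrtT_gt0) T_gt0 _ _ _ _
  _ _ _ _ Xx1 Xstar (fun t y => sf t w y) (fun t k y => sg k y (omega t w))
  (fun t y => df_le t w y) (fun t k y => dg_le k y (omega t w))
  (fun t k y => gk_le k y (omega t w)) diam (run w).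
pose Z w := \sum_(1 <= t < T.+1) \sum_(k < m)
  Q t w ord0 k * g k xstar (omega t w).
have Z_mean : bounded_nonpos_mean P Z.
  apply: bounded_nonpos_mean_sum => -[|t]; rewrite mem_index_iota// => _.
  apply: bounded_nonpos_mean_sum => k _.
  apply: (cross_term_nonpos_mean _ _ _ iid _ _ _ (t%:R * (G + D2 * Rd)) G).
  - exact: (measurableT_comp (measurable_coord R m k) (mQ t.+1 isT)).
  - by move=> w; have [+ _] := path w t; exact.
  - exact: mg.
  - by move=> o; exact: gk_le.
  - exact: Estar.
apply: (expectation_le_add_nonpos_mean P _ _ Z (Num.sqrt T%:R)^-1) => //.
  have -> : (fun w => \sum_(1 <= t < T.+1) f t w xstar) =
      (fun w => \sum_(0 <= t < T) f t.+1 w xstar).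
    by apply/funext => w; rewrite big_add1.
  apply: measurable_sum => t.
  exact: past_measurable_fun (mf t.+1 xstar isT Xstar).
move=> w; have [_] := path w T; rewrite sumrB -/(Z w) /drift_const sqrtT2.
set F := \sum_(1 <= t < T.+1) f t w (x t w); set H := \sum_(_ <= _ < _) _.
(* [regret] bounds [V * (F - H)]; dividing it by [V = sqrt T] is multiplying the
   goal by [sqrt T]. *)
move=> regret; rewrite -(ler_pM2l sqrtT_gt0) !mulrDr mulrA mulfV ?gt_eqF//.
rewrite mul1r mulrCA -expr2 sqrtT2 /C.
have TD1 : T%:R * D1 ^+ 2 / (4 * T%:R) = D1 ^+ 2 / 4.
  by field; rewrite gt_eqF.
rewrite TD1 in regret.
lra.
Qed.
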